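(* Let $F(y,z)$ be a twice differentiable real-valued function of $(y,z)\in\mathbb{R}^{N_y}\times\mathbb{R}^{N_z}$. Assume that $z_m(y)$ is well-defined, i.e. for any given $y$ there is a unique solution $z_m(y)$ of $\min_z F(y,z)$, and let $F_r(y)=F(y,z_m(y))$. Let $y^0\in\mathbb{R}^{N_y}$ be given and let $z^0=z_m(y^0)$. Let $\nabla^2F_r$ and $\nabla^2F$ be used as the (invertible) Hessian models for $F_r$ and $F$ respectively. Then the reduced method with Hessian model $B_r=\nabla^2F_r$ is equivalent to the simplified semi-reduced method with Hessian model $B=\nabla^2F$; that is, the two methods generate identical iterates.
   Context: A Hessian model for a twice differentiable function $f(u)$, $u\in\mathbb{R}^{N_u}$, is a positive definite (in particular invertible) $N_u\times N_u$ matrix-valued function of $u$ approximating $\nabla^2f(u)$. Below, $\mathscr{B}_r(y)$ denotes the Hessian model for $F_r(y)$ and $\mathscr{B}_f(y,z)$ the Hessian model for $F(y,z)$; in the claim $\mathscr{B}_r=\nabla^2F_r$ and $\mathscr{B}_f=\nabla^2F$. Both methods use the same fixed parameters $\delta\in(0,1/2)$ and $\alpha\in(0,1)$. Reduced method (backtracking line search applied to $f=F_r$). Start at $y^0$. For $k=0,1,2,\dots$: set $g=\nabla F_r(y^k)$ and $B_r=\mathscr{B}_r(y^k)$; solve $B_r\Delta y=-g$; let $y_p(s)=y^k+s\Delta y$; find the smallest integer $j\ge0$ with $F_r(y_p(\alpha^j))-F_r(y^k)\le\delta g^T(y_p(\alpha^j)-y^k)$; set $y^{k+1}=y_p(\alpha^j)$.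 Simplified semi-reduced method. Start at $x^0=(y^0,z_m(y^0))$. For $k=0,1,2,\dots$: with $x^k=(y^k,z^k)$, set $g_y=\nabla_yF(x^k)$ and $B=\mathscr{B}_f(x^k)$, with blocks $B_{yy},B_{yz},B_{zy},B_{zz}$ with respect to the splitting $x=(y,z)$, and let $B_s=B_{yy}-B_{yz}B_{zz}^{-1}B_{zy}$; solve $B_s\Delta y=-g_y$; let $x_p(s)=(y_p(s),z_p(s))=(y^k+s\Delta y,\ z_m(y^k+s\Delta y))$; find the smallest integer $j\ge0$ with $F(x_p(\alpha^j))-F(x^k)\le\delta g_y^T(y_p(\alpha^j)-y^k)$; set $x^{k+1}=x_p(\alpha^j)$. Identical iterates means that the vectors $y^k$ produced by the two methods coincide for all $k$ (the $z$-component in the second method being $z^k=z_m(y^k)$). *)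

(* Defs.v *)
From mathcomp Require Import all_boot all_order all_algebra.
From mathcomp Require Import all_classical all_reals all_analysis.
Import Order.TTheory GRing.Theory Num.Theory numFieldNormedType.Exports.

Set Implicit Arguments.
Unset Strict Implicit.
Unset Printing Implicit Defensive.

Local Open Scope ring_scope.

(* Vectors of R^n are columns 'cV[R]_n; a point (y, z) of R^Ny x R^Nz is
   [col_mx y z : 'cV[R]_(Ny + Nz)]. *)

Definition dotp (R : realType) (n : nat) (u v : 'cV[R]_n) : R :=
  (u^T *m v) 0 0.

Definition grad (R : realType) (n : nat) (f : 'cV[R]_n -> R) (u : 'cV[R]_n) :
    'cV[R]_n :=
  \col_i 'D_(delta_mx i 0) f u.

(* ['D_v f u] has a default value when the limit does not exist, so [grad] and
   [hess] carry their usual meaning only where the derivatives exist. *)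
Definition hess (R : realType) (n : nat) (f : 'cV[R]_n -> R) (u : 'cV[R]_n) :
    'M[R]_n :=
  \matrix_(i, j) 'D_(delta_mx j 0) ('D_(delta_mx i 0) f) u.

(* Frechet differentiability, of f and then of its gradient; no continuity of
   the second derivatives. *)
Definition twice_differentiable (R : realType) (n : nat)
    (f : 'cV[R]_n -> R) : Prop :=
  (forall u, differentiable f u) /\ (forall u, differentiable (grad f) u).

Definition posdefmx (R : realType) (n : nat) (A : 'M[R]_n) : Prop :=
  A^T = A /\ forall v : 'cV[R]_n, v != 0 -> 0 < dotp v (A *m v).

Definition hessian_model (R : realType) (n : nat)
    (B : 'cV[R]_n -> 'M[R]_n) : Prop :=
  forall u, posdefmx (B u).

Definition least_nat (P : nat -> Prop) (j : nat) : Prop :=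
  P j /\ forall i, (i < j)%N -> ~ P i.

(* [u] is the sequence of iterates of backtracking line search for f started at
   u0, with Hessian model B and parameters delta, alpha. *)
Definition linesearch_iterates (R : realType) (n : nat) (f : 'cV[R]_n -> R)
    (B : 'cV[R]_n -> 'M[R]_n) (delta alpha : R) (u0 : 'cV[R]_n)
    (u : nat -> 'cV[R]_n) : Prop :=
  u 0%N = u0 /\
  forall k, exists (du : 'cV[R]_n) (j : nat),
    let g := grad f (u k) in
    let up s := u k + s *: du in
    [/\ B (u k) *m du = - g,
        least_nat (fun i =>
          f (up (alpha ^+ i)) - f (u k)
            <= delta * dotp g (up (alpha ^+ i) - u k)) j
      & u k.+1 = up (alpha ^+ j)].

Section Split.
Variables (R : realType) (Ny Nz : nat).

Definition grady (F : 'cV[R]_(Ny + Nz) -> R) (x : 'cV[R]_(Ny + Nz)) :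
    'cV[R]_Ny :=
  usubmx (grad F x).

Definition schur (B : 'M[R]_(Ny + Nz)) : 'M[R]_Ny :=
  ulsubmx B - ursubmx B *m invmx (drsubmx B) *m dlsubmx B.

Definition minimizer_map (F : 'cV[R]_(Ny + Nz) -> R)
    (zm : 'cV[R]_Ny -> 'cV[R]_Nz) : Prop :=
  forall y, unique (fun z => forall z', F (col_mx y z) <= F (col_mx y z'))
                   (zm y).

Definition reduced (F : 'cV[R]_(Ny + Nz) -> R)
    (zm : 'cV[R]_Ny -> 'cV[R]_Nz) (y : 'cV[R]_Ny) : R :=
  F (col_mx y (zm y)).

(* [x] is the sequence of iterates of the simplified semi-reduced method, with
   Hessian model B for F. *)
Definition semireduced_iterates (F : 'cV[R]_(Ny + Nz) -> R)
    (zm : 'cV[R]_Ny -> 'cV[R]_Nz)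
    (B : 'cV[R]_(Ny + Nz) -> 'M[R]_(Ny + Nz)) (delta alpha : R)
    (y0 : 'cV[R]_Ny) (x : nat -> 'cV[R]_(Ny + Nz)) : Prop :=
  x 0%N = col_mx y0 (zm y0) /\
  forall k, exists (dy : 'cV[R]_Ny) (j : nat),
    let yk := usubmx (x k) in
    let gy := grady F (x k) in
    let yp s := yk + s *: dy in
    let xp s := col_mx (yp s) (zm (yp s)) in
    [/\ schur (B (x k)) *m dy = - gy,
        least_nat (fun i =>
          F (xp (alpha ^+ i)) - F (x k)
            <= delta * dotp gy (yp (alpha ^+ i) - yk)) j
      & x k.+1 = xp (alpha ^+ j)].

End Split.

(* Main.v *)
Require Import Defs.
From HB Require Import structures.
From mathcomp Require Import all_boot all_order all_algebra.
From mathcomp Require Import all_classical all_reals all_analysis.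
From mathcomp Require Import ring lra.
Import Order.TTheory GRing.Theory Num.Theory numFieldNormedType.Exports.
Local Open Scope ring_scope.

Set Implicit Arguments.
Unset Strict Implicit.
Unset Printing Implicit Defensive.

(** Write x(y) = (y, z_m(y)).  The two methods perform the same line search
    on F_r = F o x as soon as, at every point,
      grad F_r(y) = grad_y F(x(y))
    and
      hess F_r(y) = H_yy - H_yz H_zz^-1 H_zy    with H = hess F(x(y)).
    Minimality of z_m(y) gives grad_z F(x(y)) = 0.  Differentiating this
    identity gives z_m' = - H_zz^-1 H_zy; the first formula is then the chain
    rule for F o x, and the second the chain rule for grad_y F o x
    ([grad_reduced], [hess_reduced]).

    The differentiability of z_m is the delicate point.  The second
    derivatives of F need not be continuous, so the usual implicit function
    theorem does not apply.  Convexity replaces it: since hess F is positive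
    definite, grad F is monotone.  Put K = - H_zz^-1 H_zy.  To first order,
    grad_z F(y + h, z_m(y) + K h + w) is H_zz w, hence it points outwards along
    the sphere |w| = e |h| when h is small.  A zero of a monotone field cannot
    lie outside a sphere on which the field points outwards, so
    |z_m(y + h) - z_m(y) - K h| <= e |h| ([monotone_implicit_diff]): K is the
    derivative of z_m at y.

    Each line search step has exactly one outcome: the positive definite
    system has one solution, this solution is zero or a descent direction, and
    backtracking along a descent direction of a differentiable function ends
    ([linesearch_step_exists], [linesearch_step_unique]).  So each method has
    exactly one sequence of iterates ([deterministic_orbit]), and by the two
    formulas the sequences correspond ([semireduced_iterates_graph]). *)

(** * Dot product and sup norm *)

Section Dot.
Context {R : realType} {n : nat}.
Implicit Types (u v w : 'cV[R]_n) (A : 'M[R]_n).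

Lemma dotpE u v : dotp u v = \sum_i u i 0 * v i 0.
Proof. by rewrite /dotp mxE; apply: eq_bigr => i _; rewrite mxE. Qed.

Lemma dotpDl u v w : dotp (u + v) w = dotp u w + dotp v w.
Proof. by rewrite /dotp linearD mulmxDl mxE. Qed.

Lemma dotpDr u v w : dotp w (u + v) = dotp w u + dotp w v.
Proof. by rewrite /dotp mulmxDr mxE. Qed.

Lemma dotpNl u v : dotp (- u) v = - dotp u v.
Proof. by rewrite /dotp linearN mulNmx mxE. Qed.

Lemma dotpZl a u v : dotp (a *: u) v = a * dotp u v.
Proof. by rewrite /dotp linearZ -scalemxAl mxE. Qed.

Lemma dotpZr a u v : dotp u (a *: v) = a * dotp u v.
Proof. by rewrite /dotp -scalemxAr mxE. Qed.

Lemma dot0p u : dotp 0 u = 0.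
Proof. by rewrite /dotp linear0 mul0mx mxE. Qed.

Lemma dotp0 u : dotp u 0 = 0.
Proof. by rewrite /dotp mulmx0 mxE. Qed.

Lemma dotpC u v : dotp u v = dotp v u.
Proof. by rewrite !dotpE; apply: eq_bigr => i _; rewrite mulrC. Qed.

Lemma dotp_mulmx A u v : dotp u (A *m v) = dotp (A^T *m u) v.
Proof. by rewrite /dotp trmx_mul trmxK mulmxA. Qed.

Lemma dotp_delta u i : dotp u (delta_mx i 0) = u i 0.
Proof. by rewrite /dotp -colE !mxE. Qed.

End Dot.

Section SupNorm.
Context {R : realType}.

Lemma entry_le_norm m n (A : 'M[R]_(m, n)) i j : `|A i j| <= `|A|.
Proof.
rewrite [leRHS]/Num.Def.normr/= mx_normrE; exact: (le_bigmax _ _ (i, j)).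
Qed.

Lemma mx_norm_le m n (A : 'M[R]_(m, n)) (c : R) :
  0 <= c -> (forall i j, `|A i j| <= c) -> `|A| <= c.
Proof.
move=> c0 Ac; rewrite [leLHS]/Num.Def.normr/= mx_normrE.
by apply: bigmax_le => // -[i j] _; exact: Ac.
Qed.

Lemma norm_dotp_le n (u v : 'cV[R]_n) : `|dotp u v| <= n%:R * (`|u| * `|v|).
Proof.
rewrite dotpE (le_trans (ler_norm_sum _ _ _))//.
rewrite (@le_trans _ _ (\sum_(i < n) `|u| * `|v|))//.
  apply: ler_sum => i _; rewrite normrM.
  by apply: ler_pM => //; exact: entry_le_norm.
by rewrite sumr_const card_ord -[leLHS]mulr_natl.
Qed.

Lemma norm_mulmx_le m n (A : 'M[R]_(m, n)) (v : 'cV[R]_n) :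
  `|A *m v| <= n%:R * `|A| * `|v|.
Proof.
apply: mx_norm_le => [|i j]; first by rewrite !mulr_ge0.
rewrite mxE (le_trans (ler_norm_sum _ _ _))//.
rewrite (@le_trans _ _ (\sum_(k < n) `|A| * `|v|))//.
  apply: ler_sum => k _; rewrite normrM.
  by apply: ler_pM => //; exact: entry_le_norm.
by rewrite sumr_const card_ord -[leLHS]mulr_natl mulrA.
Qed.

Lemma norm_col_mx_le m n (u : 'cV[R]_m) (v : 'cV[R]_n) (c : R) :
  `|u| <= c -> `|v| <= c -> `|col_mx u v| <= c.
Proof.
move=> uc vc; apply: mx_norm_le => [|i j]; first by rewrite (le_trans _ uc).
rewrite mxE; case: (fintype.split i) => k.
  by rewrite (le_trans _ uc)// entry_le_norm.
by rewrite (le_trans _ vc)// entry_le_norm.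
Qed.

Lemma norm_usubmx_le m n (u : 'cV[R]_(m + n)) : `|usubmx u| <= `|u|.
Proof.
by apply: mx_norm_le => // i j; rewrite mxE entry_le_norm.
Qed.

Lemma norm_dsubmx_le m n (u : 'cV[R]_(m + n)) : `|dsubmx u| <= `|u|.
Proof.
by apply: mx_norm_le => // i j; rewrite mxE entry_le_norm.
Qed.

Lemma mulmx_continuous m n (A : 'M[R]_(m, n)) :
  continuous (mulmx A : 'cV[R]_n -> 'cV[R]_m).
Proof.
apply/linear_bounded_continuous/linear_boundedP.
apply: filterS (nbhs_pinfty_ge (num_real (n%:R * `|A|))) => c Ac v.
by apply: le_trans (norm_mulmx_le A v) _; rewrite ler_wpM2r.
Qed.

End SupNorm.

(** * Positive definite matrices *)

Section PosDef.
Context {R : realType}.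

Lemma posdefmx_unit n (A : 'M[R]_n) : posdefmx A -> A \in unitmx.
Proof.
move=> [AT Apos]; rewrite -row_free_unit -kermx_eq0; apply/eqP/row_matrixP => i.
rewrite row0; apply/eqP/negPn/negP => ri0.
have /Apos : (row i (kermx A))^T != 0 by rewrite trmx_eq0.
suff -> : A *m (row i (kermx A))^T = 0 by rewrite dotp0 ltxx.
by rewrite -{1}AT -trmx_mul -row_mul mulmx_ker row0 trmx0.
Qed.

Lemma posdefmx_ge0 n (A : 'M[R]_n) v : posdefmx A -> 0 <= dotp v (A *m v).
Proof.
move=> [_ Apos]; have [->|/Apos/ltW//] := eqVneq v 0.
by rewrite dot0p.
Qed.

(** The discriminant argument, on the vector r u - q v with r = <v, A v> and
    q = <u, A v>. *)
Lemma posdefmx_CauchySchwarz n (A : 'M[R]_n) u v : posdefmx A ->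
  dotp u (A *m v) ^+ 2 <= dotp u (A *m u) * dotp v (A *m v).
Proof.
move=> Apd; have [->|v0] := eqVneq v 0.
  by rewrite mulmx0 !dotp0 mulr0 expr0n.
have r0 := Apd.2 _ v0; set q := dotp u _; set r := dotp v _ in r0 *.
set p := dotp u _.
have qE : dotp v (A *m u) = q by rewrite dotp_mulmx Apd.1 dotpC.
have := posdefmx_ge0 (r *: u - q *: v) Apd.
rewrite mulmxBr -!scalemxAr -!scaleNr !dotpDl !dotpDr !dotpZl !dotpZr qE.
rewrite -/q -/p -/r => h; rewrite -subr_ge0 -(pmulr_rge0 _ r0).
by apply: le_trans h _; rewrite le_eqVlt; apply/orP; left; apply/eqP; ring.
Qed.

(** A coercivity constant without eigenvalues or compactness: the entry v_i is
    <a_i, A v> with a_i = A^-1 e_i, so Cauchy-Schwarz bounds v_i^2 by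
    <a_i, A a_i> <v, A v>. *)
Lemma posdefmx_coercive n (A : 'M[R]_n) : posdefmx A ->
  exists2 c : R, 0 < c & forall v, c * `|v| ^+ 2 <= dotp v (A *m v).
Proof.
move=> Apd; have Au := posdefmx_unit Apd.
pose a i : 'cV[R]_n := invmx A *m delta_mx i 0.
(* the summand 1 keeps s positive in dimension 0 *)
pose s := 1 + \sum_i dotp (a i) (A *m a i).
have s0 : 0 < s by rewrite ltr_pwDl// sumr_ge0// => i _; exact: posdefmx_ge0.
exists s^-1; first by rewrite invr_gt0.
move=> v; rewrite ler_pdivrMl//.
have r0 : 0 <= s * dotp v (A *m v) by rewrite mulr_ge0 ?(ltW s0)// posdefmx_ge0.
rewrite -(@ler_sqrt _ _ _ r0) sqrtr_sqr normr_id.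
apply: mx_norm_le => [|i j]; first exact: sqrtr_ge0.
rewrite -sqrtr_sqr ler_sqrt// (ord1 j).
have <- : dotp (a i) (A *m v) = v i 0.
  by rewrite dotp_mulmx Apd.1 /a mulmxA mulmxV// mul1mx dotpC dotp_delta.
apply: le_trans (posdefmx_CauchySchwarz _ _ Apd) _.
rewrite ler_wpM2r ?posdefmx_ge0// /s (bigD1 i)//= addrCA lerDl addr_ge0//.
by rewrite sumr_ge0// => k _; exact: posdefmx_ge0.
Qed.

Lemma posdefmx_drsubmx m n (A : 'M[R]_(m + n)) :
  posdefmx A -> posdefmx (drsubmx A).
Proof.
move=> [AT Apos]; split; first by rewrite trmx_drsub AT.
move=> v v0; have : col_mx (0 : 'cV[R]_m) v != 0.
  by rewrite col_mx_eq0 negb_and v0 orbT.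
move/Apos; rewrite -{1}[A]submxK mul_block_col !mulmx0 !add0r.
by rewrite /dotp tr_col_mx mul_row_col linear0 mul0mx add0r.
Qed.

End PosDef.

(** * Differentials, gradients and Hessians *)

Section Calculus.
Context {R : realType}.

Lemma is_diff_dotp n (u x : 'cV[R]_n) : is_diff x (dotp u) (dotp u).
Proof.
have lin : linear (dotp u) by move=> a v w; rewrite dotpDr dotpZr.
pose linM := GRing.isLinear.Build _ _ _ _ _ lin.
pose L : {linear 'cV[R]_n -> R^o} := HB.pack (dotp u) linM.
have Lc : continuous L.
  apply/linear_bounded_continuous/linear_boundedP.
  apply: filterS (nbhs_pinfty_ge (num_real (n%:R * `|u|))) => c Ac v.
  by apply: le_trans (norm_dotp_le u v) _; rewrite mulrA ler_wpM2r.
by apply: DiffDef; [exact: (linear_differentiable _ Lc)|exact: (diff_lin _ Lc)].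
Qed.

(** The explicit first-order estimate suffices, because every linear map between
    spaces of column vectors is continuous. *)
Lemma is_diff_mulmx m n (A : 'M[R]_(m, n)) (f : 'cV[R]_n -> 'cV[R]_m)
    (x : 'cV[R]_n) :
  (forall e : R, 0 < e ->
    \forall h \near nbhs (0 : 'cV[R]_n),
      `|f (h + x) - f x - A *m h| <= e * `|h|) ->
  is_diff x f (mulmx A).
Proof.
move=> fA; have fE : f \o shift x = cst (f x) + mulmx A +o_ (0 : 'cV[R]_n) id.
  apply/eqaddoP => e /fA; apply: filterS => h; apply: le_trans.
  by rewrite opprD addrA.
have dfE : 'd f x = mulmx A :> (_ -> _).
  exact: (diff_unique (@mulmx_continuous _ _ _ A) fE).
apply: DiffDef => //; apply/diff_locallyP; rewrite dfE; split=> //.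
exact: mulmx_continuous.
Qed.

Lemma is_diff_mulmx_near m n (A : 'M[R]_(m, n)) (f : 'cV[R]_n -> 'cV[R]_m)
    (x : 'cV[R]_n) (e : R) :
  is_diff x f (mulmx A) -> 0 < e ->
  \forall h \near nbhs (0 : 'cV[R]_n), `|f (h + x) - f x - A *m h| <= e * `|h|.
Proof.
move=> [df dfE] e0; have /eqaddoP /(_ _ e0) := diff_locally df.
by rewrite dfE; apply: filterS => h /=; rewrite opprD addrA.
Qed.

Lemma is_derive_line (V W : normedModType R) (f : V -> W) (x v : V) (t : R) :
  differentiable f (t *: v + x) ->
  is_derive t 1 (fun s => f (s *: v + x)) ('d f (t *: v + x) v).
Proof.
move=> df; pose c (s : R) := s *: v + x.
have dc : is_diff t c ( *:%R^~ v).
  have := @is_diffD _ _ _ _ _ _ _ t (is_diff_scalel t v) (is_diff_cst x t).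
  by rewrite addr0.
have dfc : differentiable (f \o c) t by apply: differentiable_comp.
apply: DeriveDef; first exact: diff_derivable.
by rewrite deriveE// diff_comp//= (diff_val (is_diff_def := dc)) scale1r.
Qed.

Lemma vec_sum_delta n (v : 'cV[R]_n) : v = \sum_i v i 0 *: delta_mx i 0.
Proof.
by rewrite {1}[v]matrix_sum_delta; apply: eq_bigr => i _; rewrite big_ord1.
Qed.

Lemma diff_grad n (f : 'cV[R]_n -> R) u v :
  differentiable f u -> 'd f u v = dotp (grad f u) v.
Proof.
move=> df; rewrite {1}[v]vec_sum_delta linear_sum dotpE.
by apply: eq_bigr => i _; rewrite linearZ/= mxE deriveE// mulrC.
Qed.

(** The partial derivatives that define [hess f u] are entries of directional
    derivatives of [grad f], the row index selecting the entry. *)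
Lemma diff_gradient n (f : 'cV[R]_n -> R) u v :
  differentiable (grad f) u -> 'd (grad f) u v = hess f u *m v.
Proof.
move=> dg; rewrite {1}[v]vec_sum_delta linear_sum; apply/colP => i.
rewrite summxE mxE; apply: eq_bigr => j _; rewrite linearZ/= mxE mulrC.
congr (_ * _); rewrite mxE -deriveE// derive_mx; last exact: diff_derivable.
rewrite mxE; congr ('D_ _ _ u); apply/funext => x; by rewrite mxE.
Qed.

Lemma grad_min_dotp0 n (f : 'cV[R]_n -> R) u v :
  (forall w, differentiable f w) ->
  (forall t : R, f u <= f (t *: v + u)) -> dotp (grad f u) v = 0.
Proof.
move=> df fmin; pose l (t : R) := f (t *: v + u).
have dl (t : R) : is_derive t 1 l ('d f (t *: v + u) v).
  exact: is_derive_line.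
have l0 : l 0 = f u by rewrite /l scale0r add0r.
have /@derive_val : is_derive (0 : R) 1 l 0.
  apply: (@derive1_at_min _ l (-1) 1 0).
  - exact: le_trans (lerN10 R) ler01.
  - by move=> t _; have [] := dl t.
  - by rewrite in_itv/= ltrN10 ltr01.
  - by move=> t _; rewrite l0; exact: fmin.
by have /@derive_val -> := dl 0; rewrite scale0r add0r diff_grad.
Qed.

(** Mean value theorem for t |-> <d, grad f(u + t d)> with d = v - u, whose
    derivative is <d, hess f d>. *)
Lemma grad_monotone n (f : 'cV[R]_n -> R) u v :
  (forall w, differentiable (grad f) w) ->
  (forall w d, 0 <= dotp d (hess f w *m d)) ->
  0 <= dotp (grad f v - grad f u) (v - u).
Proof.
move=> dg hpos; set d := v - u.
have dl (t : R) : is_derive t 1 (fun s : R => dotp d (grad f (s *: d + u)))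
    (dotp d (hess f (t *: d + u) *m d)).
  have dd w : differentiable (dotp d \o grad f) w.
    apply: differentiable_comp => //.
    exact: (@ex_diff _ _ _ _ _ _ _ (is_diff_dotp _ _)).
  have := is_derive_line (dd (t *: d + u)).
  rewrite diff_comp//= ?diff_gradient//; last first.
    exact: (@ex_diff _ _ _ _ _ _ _ (is_diff_dotp _ _)).
  by rewrite (@diff_val _ _ _ _ _ _ _ (is_diff_dotp _ _)).
have := @MVT R _ _ 0 1 ltr01 (fun t _ => dl t).
case=> [|c _].
  apply/continuous_subspaceT => t; apply/differentiable_continuous.
  by apply/derivable1_diffP.
rewrite scale1r scale0r add0r /d subrK subr0 mulr1 -/d => E.
by rewrite dotpC dotpDr -[- grad f u]scaleN1r dotpZr mulN1r E.
Qed.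

End Calculus.

(** * Implicit differentiation of zeros of a monotone field *)

Section MonotoneImplicit.
Context {R : realType} {m n : nat}.

(** An implicit function theorem that asks for the derivative of G at one point
    only.  With K = - (d_z G)^-1 d_y G, put W = zeta(h + y) - zeta(y) - K h.  If
    |W| > e |h|, scale W to the vector w of norm e |h|.  By coercivity,
    <w, G(h + y, zeta(y) + K h + w)> > 0.  The zero zeta(h + y) lies further out
    on the same ray, so monotonicity of G(h + y, .) gives the opposite sign. *)
Lemma monotone_implicit_diff (G : 'cV[R]_(m + n) -> 'cV[R]_n)
    (J : 'M[R]_(n, m + n)) (zeta : 'cV[R]_m -> 'cV[R]_n) (y : 'cV[R]_m)
    (c : R) :
  (forall p z z',
    0 <= dotp (G (col_mx p z') - G (col_mx p z)) (z' - z)) ->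
  (forall p, G (col_mx p (zeta p)) = 0) ->
  is_diff (col_mx y (zeta y)) G (mulmx J) ->
  rsubmx J \in unitmx ->
  0 < c -> (forall w : 'cV[R]_n, c * `|w| ^+ 2 <= dotp w (rsubmx J *m w)) ->
  is_diff y zeta (mulmx (- (invmx (rsubmx J) *m lsubmx J))).
Proof.
move=> Gmono G0 dG Ju c0 Jc; set K := - _; set x := col_mx y (zeta y) in dG *.
apply: is_diff_mulmx => e e0.
(* K is chosen so that J annihilates the displacement (h, K h) *)
have JK (h : 'cV[R]_m) (w : 'cV[R]_n) :
  J *m col_mx h (K *m h + w) = rsubmx J *m w.
  rewrite -{1}[J]hsubmxK mul_row_col mulmxDr mulmxA /K mulmxN mulmxA mulmxV//.
  by rewrite mul1mx mulNmx addrA subrr add0r.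
pose C : R := 1 + m%:R * `|K| + e.
have C0 : 0 < C by rewrite addr_gt0// ltr_pwDl// mulr_ge0.
have dispC (h : 'cV[R]_m) (w : 'cV[R]_n) :
  `|w| <= e * `|h| -> `|col_mx h (K *m h + w)| <= C * `|h|.
  move=> we; have Kh := norm_mulmx_le K h.
  have [Kh0 eh0] : 0 <= m%:R * `|K| * `|h| /\ 0 <= e * `|h|.
    by rewrite !mulr_ge0// ltW.
  apply: norm_col_mx_le; rewrite /C !mulrDl mul1r.
    by rewrite -addrA lerDl addr_ge0.
  rewrite (le_trans (ler_normD _ _))// lerD//.
  by rewrite (le_trans Kh)// lerDr.
(* e' is small enough for the remainder in <w, G>, at most
   n e |h| e' C |h|, to stay below the coercive term c (e |h|)^2 *)
have [N N0 nN] : exists2 N : R, 0 < N & n%:R < N.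
  by exists n.+1%:R; rewrite ?ltr0n ?ltr_nat.
pose e' := c * e / (N * C).
have e'0 : 0 < e' by rewrite divr_gt0 ?mulr_gt0.
have /nbhs_norm0P[r /= r0 Gr] := is_diff_mulmx_near dG e'0.
have rC : 0 < r / C by rewrite divr_gt0.
apply/(@nbhs_norm0P R 'cV[R]_m); exists (r / C) => // h /=.
rewrite ltr_pdivlMr// => hr.
set W := zeta (h + y) - zeta y - K *m h.
rewrite leNgt; apply/negP => We.
have W0 : 0 < `|W| by rewrite (le_lt_trans _ We)// mulr_ge0// ltW.
have h0 : 0 < `|h|.
  rewrite lt_neqAle normr_ge0 andbT eq_sym normr_eq0; apply/eqP => hE.
  by move: W0; rewrite /W hE add0r mulmx0 subr0 subrr normr0 ltxx.
pose t := e * `|h| / `|W|.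
have t0 : 0 < t by rewrite divr_gt0// mulr_gt0.
have t1 : t < 1 by rewrite ltr_pdivrMr// mul1r.
have tW : `|t *: W| = e * `|h| by rewrite normrZ gtr0_norm// /t divfK ?gt_eqF.
set w := t *: W in tW *.
pose k := col_mx h (K *m h + w).
have kx : k + x = col_mx (h + y) (K *m h + w + zeta y).
  by rewrite /k /x add_col_mx.
have kC : `|k| <= C * `|h| by apply: dispC; rewrite tW.
have kr : `|k| < r by rewrite (le_lt_trans kC)// mulrC.
have Gk := Gr _ kr; rewrite /= G0 subr0 JK in Gk.
have out : 0 < dotp w (G (k + x)).
  rewrite -[G _](subrK (rsubmx J *m w)) dotpDr.
  set D := G _ - _ in Gk *.
  have D1 : `|dotp w D| <= n%:R * ((e * `|h|) * (e' * (C * `|h|))).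
    rewrite (le_trans (norm_dotp_le _ _))// ler_wpM2l// tW.
    by rewrite ler_wpM2l ?mulr_ge0 ?(ltW e0)// (le_trans Gk)// ler_wpM2l// ltW.
  have D2 : n%:R * ((e * `|h|) * (e' * (C * `|h|))) < c * `|w| ^+ 2.
    have -> : n%:R * ((e * `|h|) * (e' * (C * `|h|))) =
              n%:R / N * (c * `|w| ^+ 2).
      by rewrite tW /e'; field; rewrite !gt_eqF.
    rewrite gtr_pMl; first by rewrite ltr_pdivrMr// mul1r.
    by rewrite mulr_gt0// exprn_gt0// tW mulr_gt0.
  rewrite -ltrBlDl sub0r (lt_le_trans _ (Jc w))// (le_lt_trans _ D2)//.
  by rewrite (le_trans _ D1)// -normrN ler_norm.
have := Gmono (h + y) (K *m h + w + zeta y) (zeta (h + y)).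
have -> : zeta (h + y) - (K *m h + w + zeta y) = (1 - t) *: W.
  rewrite scalerBl scale1r -/w !opprD !addrA addrAC.
  by congr (_ - _); rewrite addrAC.
rewrite G0 sub0r dotpNl dotpZr -kx.
have -> : W = t^-1 *: w by rewrite scalerA mulVf ?scale1r// gt_eqF.
rewrite dotpZr dotpC leNgt oppr_lt0 !mulr_gt0// ?invr_gt0//.
by rewrite subr_gt0.
Qed.

End MonotoneImplicit.

(** * Differentials of block components *)

Section DiffBlocks.
Context {R : realType}.

Lemma is_diff_usubmx m n p (f : 'cV[R]_p -> 'cV[R]_(m + n)) A x :
  is_diff x f (mulmx A) -> is_diff x (usubmx \o f) (mulmx (usubmx A)).
Proof.
move=> df; apply: is_diff_mulmx => e /(is_diff_mulmx_near df).
apply: filterS => h; apply: le_trans.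
by rewrite /= mul_usub_mx -!linearB; exact: norm_usubmx_le.
Qed.

Lemma is_diff_dsubmx m n p (f : 'cV[R]_p -> 'cV[R]_(m + n)) A x :
  is_diff x f (mulmx A) -> is_diff x (dsubmx \o f) (mulmx (dsubmx A)).
Proof.
move=> df; apply: is_diff_mulmx => e /(is_diff_mulmx_near df).
apply: filterS => h; apply: le_trans.
by rewrite /= mul_dsub_mx -!linearB; exact: norm_dsubmx_le.
Qed.

Lemma is_diff_graph m n (f : 'cV[R]_m -> 'cV[R]_n) A x :
  is_diff x f (mulmx A) ->
  is_diff x (fun y => col_mx y (f y)) (mulmx (col_mx 1%:M A)).
Proof.
move=> df; apply: is_diff_mulmx => e e0.
apply: filterS (is_diff_mulmx_near df e0) => h fh.
rewrite mul_col_mx mul1mx !opp_col_mx !add_col_mx addrK subrr.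
by apply: norm_col_mx_le => //; rewrite normr0 mulr_ge0// ltW.
Qed.

Lemma is_diff_mulmx_comp m n p (f : 'cV[R]_m -> 'cV[R]_n)
    (g : 'cV[R]_n -> 'cV[R]_p) A B x :
  is_diff x f (mulmx A) -> is_diff (f x) g (mulmx B) ->
  is_diff x (g \o f) (mulmx (B *m A)).
Proof.
move=> df dg; have -> : mulmx (B *m A) = mulmx B \o mulmx A :> ('cV_m -> _).
  by apply/funext => v /=; rewrite mulmxA.
exact: is_diff_comp.
Qed.

Lemma mulmx_inj m n (A B : 'M[R]_(m, n)) :
  (forall v : 'cV[R]_n, A *m v = B *m v) -> A = B.
Proof.
move=> AB; apply/matrixP => i j.
by have := AB (delta_mx j 0); rewrite -!colE => /colP/(_ i); rewrite !mxE.
Qed.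

Lemma is_diff_gradient n (f : 'cV[R]_n -> R) u :
  differentiable (grad f) u -> is_diff u (grad f) (mulmx (hess f u)).
Proof.
by move=> dg; apply: DiffDef => //; apply/funext => v; rewrite diff_gradient.
Qed.

End DiffBlocks.

(** * Gradient and Hessian of the reduced function *)

Section Reduced.
Variables (R : realType) (Ny Nz : nat) (F : 'cV[R]_(Ny + Nz) -> R).
Variable zm : 'cV[R]_Ny -> 'cV[R]_Nz.
Hypothesis F_twice_diff : twice_differentiable F.
Hypothesis zm_min : minimizer_map F zm.
Hypothesis hess_F : hessian_model (hess F).

Let graph y := col_mx y (zm y).

Lemma gradz_eq0 y : dsubmx (grad F (graph y)) = 0.
Proof.
apply/colP => i; rewrite mxE [RHS]mxE -dotp_delta.
apply: grad_min_dotp0 => [w|t]; first exact: F_twice_diff.1.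
have -> : delta_mx (rshift Ny i) 0 = col_mx 0 (delta_mx i 0)
    :> 'cV[R]_(Ny + Nz).
  apply/colP => k; rewrite !mxE; case: splitP => j kj; rewrite !mxE andbT.
    by apply/eqP; rewrite -val_eqE /= kj ltn_eqF// ltn_addr.
  by rewrite -val_eqE /= kj eqn_add2l andbT.
rewrite scale_col_mx scaler0 add_col_mx add0r.
exact: (zm_min y).1.
Qed.

Lemma is_diff_minimizer y :
  let H := hess F (graph y) in
  is_diff y zm (mulmx (- (invmx (drsubmx H) *m dlsubmx H))).
Proof.
move=> H; have Hpd := posdefmx_drsubmx (hess_F (graph y)).
have [c c0 Hc] := posdefmx_coercive Hpd.
apply: (@monotone_implicit_diff _ _ _ (dsubmx \o grad F) (dsubmx H) zm y c)
  => //.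
- move=> p z z'.
  have := @grad_monotone _ _ F (col_mx p z) (col_mx p z') F_twice_diff.2
    (fun w d => posdefmx_ge0 d (hess_F w)).
  rewrite opp_col_mx add_col_mx subrr.
  rewrite -{1}[grad F _ - _]vsubmxK /dotp tr_col_mx mul_row_col mulmx0 add0r.
  by rewrite [dsubmx (_ - _)]linearB.
- exact: gradz_eq0.
- exact/is_diff_dsubmx/is_diff_gradient/F_twice_diff.2.
- exact: posdefmx_unit.
Qed.

Lemma reduced_differentiable y : differentiable (reduced F zm) y.
Proof.
apply: (@differentiable_comp _ _ _ _ graph F).
  exact: (ex_diff (is_diff_def := is_diff_graph (is_diff_minimizer y))).
exact: F_twice_diff.1.
Qed.

(** Envelope theorem: the variation of the minimizer is multiplied by
    grad_z F = 0. *)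
Lemma grad_reduced y : grad (reduced F zm) y = grady F (graph y).
Proof.
have dgr := is_diff_graph (is_diff_minimizer y).
apply/colP => i; rewrite -[LHS]dotp_delta -diff_grad; last first.
  exact: reduced_differentiable.
have -> : 'd (reduced F zm) y = 'd F (graph y) \o 'd graph y :> (_ -> _).
  apply: (@diff_comp _ _ _ _ graph F).
    exact: (ex_diff (is_diff_def := dgr)).
  exact: F_twice_diff.1.
rewrite (diff_val (is_diff_def := dgr)) /= diff_grad; last first.
  exact: F_twice_diff.1.
rewrite -[grad F _]vsubmxK gradz_eq0 mul_col_mx mul1mx /dotp tr_col_mx.
by rewrite mul_row_col trmx0 mul0mx addr0 -colE !mxE.
Qed.

(** The derivative of y |-> (y, z_m(y)) is the block column (1, - H_zz^-1 H_zy),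
    and the upper half of H times it is the Schur complement. *)
Lemma hess_reduced y : hess (reduced F zm) y = schur (hess F (graph y)).
Proof.
set H := hess F _.
have dG : is_diff y (grad (reduced F zm)) (mulmx (usubmx H *m
    col_mx 1%:M (- (invmx (drsubmx H) *m dlsubmx H)))).
  have -> : grad (reduced F zm) = (usubmx \o grad F) \o graph.
    by apply/funext => p; rewrite grad_reduced.
  apply: is_diff_mulmx_comp; first exact/is_diff_graph/is_diff_minimizer.
  exact/is_diff_usubmx/is_diff_gradient/F_twice_diff.2.
apply: mulmx_inj => v; rewrite -diff_gradient; last first.
  exact: (ex_diff (is_diff_def := dG)).
rewrite (diff_val (is_diff_def := dG)); congr (_ *m v).
rewrite -[usubmx H]hsubmxK mul_row_col mulmx1 mulmxN mulmxA.
by [].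
Qed.

End Reduced.

(** * Backtracking line search *)

Section LineSearch.
Context {R : realType} {n : nat}.
Implicit Types (f : 'cV[R]_n -> R) (M : 'M[R]_n) (g u du : 'cV[R]_n).

(** The condition that [linesearch_iterates] places on consecutive iterates: the
    iterates are then an orbit of a relation between points. *)
Definition linesearch_step f M g (delta alpha : R) u u' : Prop :=
  exists (du : 'cV[R]_n) (j : nat),
    let up s := u + s *: du in
    [/\ M *m du = - g,
        least_nat (fun i =>
          f (up (alpha ^+ i)) - f u
            <= delta * dotp g (up (alpha ^+ i) - u)) j
      & u' = up (alpha ^+ j)].

Lemma least_nat_exists (P : pred nat) :
  (exists i, P i) -> exists j, least_nat P j.
Proof.
move=> exP; case: (ex_minnP exP) => j Pj jmin; exists j; split=> // i ij /jmin.
by rewrite leqNgt ij.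
Qed.

Lemma least_nat_inj (P : nat -> Prop) i j :
  least_nat P i -> least_nat P j -> i = j.
Proof.
move=> [Pi imin] [Pj jmin]; case: (ltngtP i j) => // ij.
- by have := jmin _ ij.
- by have := imin _ ij.
Qed.

(** With slope p = <grad f(u), du> < 0, the increment of f along s du is at most
    s p + e s |du|; the value of e below makes this s delta p. *)
Lemma armijo_exists f u du (delta alpha : R) :
  differentiable f u -> dotp (grad f u) du < 0 -> delta < 1 -> 0 < alpha < 1 ->
  exists i, f (u + alpha ^+ i *: du) - f u
    <= delta * dotp (grad f u) (u + alpha ^+ i *: du - u).
Proof.
move=> df; set p := dotp _ du => p0 d1 /andP[a0 a1].
have du0 : 0 < `|du|.
  rewrite normr_gt0; apply/eqP => duE.
  by move: p0; rewrite /p duE dotp0 ltxx.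
pose e := (1 - delta) * - p / `|du|.
have e0 : 0 < e by rewrite divr_gt0// mulr_gt0 ?oppr_gt0// subr_gt0.
have /eqaddoP /(_ _ e0) := diff_locally df.
move=> /nbhs_norm0P [r /= r0 fr].
have [i ir] : exists i, alpha ^+ i * `|du| < r.
  have := @cvg_expr R alpha; rewrite gtr0_norm// => /(_ a1).
  move=> /cvgrPdist_lt /(_ (r / `|du|)); rewrite divr_gt0// => /(_ isT)[i _ ai].
  exists i; have := ai i (leqnn i).
  rewrite /= sub0r normrN gtr0_norm ?exprn_gt0//.
  by rewrite ltr_pdivlMr.
have s0 : 0 < alpha ^+ i by exact: exprn_gt0.
exists i; set s := alpha ^+ i in ir s0 *.
have sdu : `|s *: du| < r by rewrite normrZ gtr0_norm.
have fs : `|f (s *: du + u) - (f u + 'd f u (s *: du))| <= e * `|s *: du|.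
  exact: fr sdu.
rewrite [_ + _ - u]addrAC subrr add0r dotpZr -/p [u + _]addrC.
move: (le_trans (ler_norm _) fs).
rewrite diff_grad// dotpZr -/p normrZ gtr0_norm//.
have -> : e * (s * `|du|) = s * ((1 - delta) * - p).
  by rewrite /e; field; rewrite gt_eqF.
by move=> h; lra.
Qed.

Lemma linesearch_step_unique f M g (delta alpha : R) u u1 u2 :
  M \in unitmx -> linesearch_step f M g delta alpha u u1 ->
  linesearch_step f M g delta alpha u u2 -> u1 = u2.
Proof.
move=> Mu [d1 [j1 [Md1 j1P ->]]] [d2 [j2 [Md2 j2P ->]]].
have d12 : d1 = d2 by rewrite -[d1](mulKmx Mu) -[d2](mulKmx Mu) Md1 Md2.
by rewrite d12 in j1P *; rewrite (least_nat_inj j1P j2P).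
Qed.

Lemma linesearch_step_exists f M (delta alpha : R) u :
  posdefmx M -> differentiable f u -> delta < 1 -> 0 < alpha < 1 ->
  exists u', linesearch_step f M (grad f u) delta alpha u u'.
Proof.
move=> Mpd df d1 a01; set g := grad f u.
pose du := - (invmx M *m g).
have Mdu : M *m du = - g by rewrite mulmxN mulKVmx// posdefmx_unit.
suff /least_nat_exists[j jP] : exists i, f (u + alpha ^+ i *: du) - f u
    <= delta * dotp g (u + alpha ^+ i *: du - u).
  by exists (u + alpha ^+ j *: du), du, j.
(* at a critical point the step is zero and j = 0 is accepted *)
have [du0|du0] := eqVneq du 0.
  by exists 0%N; rewrite du0 scaler0 addr0 !subrr dotp0 mulr0.
apply: armijo_exists => //.
by rewrite -/g -[g]opprK -Mdu dotpNl oppr_lt0 dotpC Mpd.2.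
Qed.

End LineSearch.

(** * Equivalence of the two methods *)

Lemma deterministic_orbit (T : Type) (step : T -> T -> Prop) (x0 : T) :
  (forall x, exists x', step x x') ->
  (forall x x1 x2, step x x1 -> step x x2 -> x1 = x2) ->
  exists y : nat -> T, forall y' : nat -> T,
    (y' 0%N = x0 /\ forall k, step (y' k) (y' k.+1)) <-> y' = y.
Proof.
move=> /choice[next nextP] step_inj.
exists (fun k => iter k next x0) => y'; split=> [[y0 yS]|->//].
apply/funext; elim=> //= k IHk.
by apply: step_inj (yS k) _; rewrite IHk.
Qed.

(** Every iterate of the semi-reduced method lies on the graph of z_m, where the
    Schur complement and the partial gradient are the Hessian and the gradient
    of the reduced function. *)
Lemma semireduced_iterates_graph (R : realType) (Ny Nz : nat)
    (F : 'cV[R]_(Ny + Nz) -> R) (zm : 'cV[R]_Ny -> 'cV[R]_Nz)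
    (delta alpha : R) (y0 : 'cV[R]_Ny) (x : nat -> 'cV[R]_(Ny + Nz)) :
  twice_differentiable F -> minimizer_map F zm -> hessian_model (hess F) ->
  semireduced_iterates F zm (hess F) delta alpha y0 x <->
  exists2 y, x = (fun k => col_mx (y k) (zm (y k))) &
    linesearch_iterates (reduced F zm) (hess (reduced F zm)) delta alpha y0 y.
Proof.
move=> F2 zmin HF; split=> [[x0 xS]|[y -> [y0E yS]]]; last first.
  split=> [|k]; first by rewrite y0E.
  have [dy [j [By jP yE]]] := yS k; exists dy, j.
  rewrite col_mxKu -(hess_reduced F2 zmin HF) -(grad_reduced F2 zmin HF).
  by split=> //; rewrite yE.
have xE k : x k = col_mx (usubmx (x k)) (zm (usubmx (x k))).
  case: k => [|k]; first by rewrite x0 col_mxKu.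
  by have [dy [j [_ _ ->]]] := xS k; rewrite col_mxKu.
exists (fun k => usubmx (x k)); first exact/funext.
split=> [|k]; first by rewrite x0 col_mxKu.
have [dy [j [By jP yE]]] := xS k; exists dy, j.
rewrite (hess_reduced F2 zmin HF) (grad_reduced F2 zmin HF) /reduced -xE.
by split=> //; rewrite yE col_mxKu.
Qed.

Theorem proposition3 (R : realType) (Ny Nz : nat)
    (F : 'cV[R]_(Ny + Nz) -> R) (zm : 'cV[R]_Ny -> 'cV[R]_Nz)
    (delta alpha : R) (y0 : 'cV[R]_Ny)
    (F_twice_diff : twice_differentiable F)
    (zm_min : minimizer_map F zm)
    (hess_F : hessian_model (hess F))
    (hess_Fr : hessian_model (hess (reduced F zm)))
    (delta_int : 0 < delta < 2^-1)
    (alpha_int : 0 < alpha < 1) :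
  exists y : nat -> 'cV[R]_Ny,
    (forall y' : nat -> 'cV[R]_Ny,
       linesearch_iterates (reduced F zm) (hess (reduced F zm))
         delta alpha y0 y' <-> y' = y) /\
    (forall x' : nat -> 'cV[R]_(Ny + Nz),
       semireduced_iterates F zm (hess F) delta alpha y0 x' <->
       x' = (fun k => col_mx (y k) (zm (y k)))).
Proof.
have delta1 : delta < 1.
  by have /andP[_ /lt_trans] := delta_int; apply; rewrite invf_lt1// ltr1n.
pose step u := linesearch_step (reduced F zm) (hess (reduced F zm) u)
  (grad (reduced F zm) u) delta alpha u.
have [y yP] : exists y : nat -> 'cV[R]_Ny, forall y' : nat -> 'cV[R]_Ny,
    linesearch_iterates (reduced F zm) (hess (reduced F zm))
      delta alpha y0 y' <-> y' = y.
  apply: (@deterministic_orbit _ step) => [u|u u1 u2].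
    apply: linesearch_step_exists => //.
    exact: reduced_differentiable F_twice_diff zm_min hess_F u.
  exact/linesearch_step_unique/posdefmx_unit.
exists y; split=> // x'.
rewrite semireduced_iterates_graph//; split=> [[y' -> /yP -> //]|->].
by exists y => //; apply/yP.
Qed.
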